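(* There exists a ring $S$ that satisfies the generating hypothesis but is not von Neumann regular.
   Context: Rings are associative with unit (not necessarily commutative). $\mathcal{D}(S)$ is the unbounded derived category of right $S$-modules. A perfect complex is a bounded chain complex of finitely generated projective right $S$-modules. $S$ satisfies the generating hypothesis if whenever $f\colon X\to Y$ is a map in $\mathcal{D}(S)$ between perfect complexes with $H_*f=0$, then $f=0$ in $\mathcal{D}(S)$ (equivalently, $f$ is chain homotopic to $0$). $S$ is von Neumann regular if for every $x\in S$ there is $y\in S$ with $x=xyx$. *)

(* Defs.v *)
From HB Require Import structures.
From mathcomp Require Import all_boot all_order all_algebra.

Set Implicit Arguments.
Unset Strict Implicit.
Unset Printing Implicit Defensive.

Import GRing.Theory.

Local Open Scope ring_scope.

(** Everything up to [generating_hypothesis] is about left modules over a ring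
    [R]; right [S]-modules are obtained as left modules over the converse ring
    [S^c], with [v . a := a *: v]. *)

Definition finitely_generated (R : pzRingType) (M : lmodType R) : Prop :=
  exists (n : nat) (v : 'I_n -> M),
    forall x : M, exists a : 'I_n -> R, x = \sum_(i < n) a i *: v i.

Definition projective (R : pzRingType) (P : lmodType R) : Prop :=
  forall (M N : lmodType R) (p : {linear M -> N}) (g : {linear P -> N}),
    (forall y : N, exists x : M, p x = y) ->
    exists h : {linear P -> M}, forall x : P, p (h x) = g x.

(** Complexes are indexed homologically by all integers.  The differential
    starting in degree [n + 1] is named [diff n], so that no transport along
    [n - 1 + 1 = n] is ever needed; accordingly, conditions in a given degree
    are stated in degree [n + 1] for all [n : int]. *)
Record complex (R : pzRingType) := Complex {
  obj :> int -> lmodType R;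
  diff : forall n : int, {linear obj (n + 1) -> obj n};
  diffK : forall (n : int) (x : obj (n + 1 + 1)), diff n (diff (n + 1) x) = 0
}.

Record chain_map (R : pzRingType) (X Y : complex R) := ChainMap {
  cmap :> forall n : int, {linear X n -> Y n};
  cmap_diff : forall (n : int) (x : X (n + 1)),
    cmap n (diff X n x) = diff Y n (cmap (n + 1) x)
}.

Definition cm_id (R : pzRingType) (X : complex R) : chain_map X X :=
  @ChainMap R X X (fun n => idfun) (fun n x => erefl).

Lemma cm_zero_subproof (R : pzRingType) (X Y : complex R) (n : int)
    (x : X (n + 1)) :
  (\0 : {linear X n -> Y n}) (diff X n x) =
  diff Y n ((\0 : {linear X (n + 1) -> Y (n + 1)}) x).
Proof. by rewrite /= linear0. Qed.

Definition cm_zero (R : pzRingType) (X Y : complex R) : chain_map X Y :=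
  ChainMap (@cm_zero_subproof R X Y).

Lemma cm_comp_subproof (R : pzRingType) (X Y Z : complex R)
    (g : chain_map Y Z) (f : chain_map X Y) (n : int) (x : X (n + 1)) :
  (g n \o f n) (diff X n x) = diff Z n ((g (n + 1) \o f (n + 1)) x).
Proof. by rewrite /= !cmap_diff. Qed.

Definition cm_comp (R : pzRingType) (X Y Z : complex R)
    (g : chain_map Y Z) (f : chain_map X Y) : chain_map X Z :=
  @ChainMap R X Z (fun n => g n \o f n) (cm_comp_subproof g f).

Definition homotopic (R : pzRingType) (X Y : complex R)
    (f g : chain_map X Y) : Prop :=
  exists h : forall n : int, {linear X n -> Y (n + 1)},
    forall (n : int) (x : X (n + 1)),
      f (n + 1) x - g (n + 1) x =
      diff Y (n + 1) (h (n + 1) x) + h n (diff X n x).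

(** [H_(n+1) X] is the set of cycles in degree [n + 1] modulo [homologous]. *)
Definition cycle (R : pzRingType) (X : complex R) (n : int) (x : X (n + 1)) :
  Prop := diff X n x = 0.

Definition homologous (R : pzRingType) (X : complex R) (n : int)
    (x y : X (n + 1)) : Prop :=
  exists w : X (n + 1 + 1), x - y = diff X (n + 1) w.

Definition quasi_iso (R : pzRingType) (X Y : complex R) (f : chain_map X Y) :
  Prop :=
  forall n : int,
    (forall x x' : X (n + 1), cycle x -> cycle x' ->
       homologous (f (n + 1) x) (f (n + 1) x') -> homologous x x') /\
    (forall y : Y (n + 1), cycle y ->
       exists2 x : X (n + 1), cycle x & homologous (f (n + 1) x) y).

(** The derived category is the localization of the homotopy category at the
    quasi-isomorphisms: by the calculus of fractions, a morphism [X -> Y] is a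
    roof [X <- Z -> Y] whose left leg is a quasi-isomorphism, up to [roof_eq].
    The apex [Z] is an arbitrary, possibly unbounded, complex. *)
Record roof (R : pzRingType) (X Y : complex R) := Roof {
  apex : complex R;
  roof_left : chain_map apex X;
  roof_right : chain_map apex Y;
  roof_left_qi : quasi_iso roof_left
}.

Definition roof_eq (R : pzRingType) (X Y : complex R) (a b : roof X Y) : Prop :=
  exists (W : complex R) (s : chain_map W (apex a)) (t : chain_map W (apex b)),
    [/\ quasi_iso (cm_comp (roof_left a) s),
        homotopic (cm_comp (roof_left a) s) (cm_comp (roof_left b) t) &
        homotopic (cm_comp (roof_right a) s) (cm_comp (roof_right b) t)].

Lemma cm_id_qi (R : pzRingType) (X : complex R) : quasi_iso (cm_id X).
Proof.
move=> n; split=> [x x' _ _ //|y cy]; exists y => //.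
by exists 0; rewrite subrr linear0.
Qed.

Definition roof_zero (R : pzRingType) (X Y : complex R) : roof X Y :=
  Roof (cm_zero X Y) (@cm_id_qi R X).

(** The map induced in homology by the roof [a] is the right leg composed with
    the inverse of the left leg: it sends the class of [x] to the class of
    [roof_right a z], for any cycle [z] with [roof_left a z] homologous to
    [x]. *)
Definition roof_homology_zero (R : pzRingType) (X Y : complex R)
    (a : roof X Y) : Prop :=
  forall (n : int) (x : X (n + 1)) (z : apex a (n + 1)),
    cycle x -> cycle z -> homologous (roof_left a (n + 1) z) x ->
    homologous (roof_right a (n + 1) z) 0.

Definition perfect (R : pzRingType) (X : complex R) : Prop :=
  (exists N : nat, forall n : int, (N < `|n|)%N -> forall x : X n, x = 0) /\
  (forall n : int, finitely_generated (X n) /\ projective (X n)).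

Definition generating_hypothesis (S : pzRingType) : Prop :=
  forall (X Y : complex S^c) (f : roof X Y),
    perfect X -> perfect Y ->
    roof_homology_zero f -> roof_eq f (roof_zero X Y).

Definition von_neumann_regular (S : pzRingType) : Prop :=
  forall x : S, exists y : S, x = x * y * x.

(* Main.v *)
Require Import Defs.
From HB Require Import structures.
From mathcomp Require Import all_boot all_order all_algebra.
From mathcomp Require Import boolp functions.
From mathcomp Require Import zify.

(** A map between perfect complexes that vanishes in homology is killed degree
    by degree as soon as matrices over [S] satisfy two conditions: (1) if [C]
    maps the kernel of [A] into the image of [B], then [C = D A + B E], that
    is, Ext^1 vanishes between finitely presented modules; (2) if [A B = 0],
    then [A W = 0] and [W B = B] for some [W], that is, finitely generated
    submodules of free modules are flat.

    Let [T] be the ring of upper triangular 2x2 matrices over a field [F]: it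
    is hereditary, not regular, and has three indecomposable modules
    [P = F^2], [S1], [S2].  It embeds in the regular ring
    [E = End P x End S1 x End S2], and [S] is the ring of sequences in [E]
    that are eventually constant with value in [T].  Each term of a matrix
    equation over [S] is solvable because [E] is regular, and its limit is
    solvable in [T]: for (2) because [T] is hereditary, and for (1) because
    the kernel condition, tested on every indecomposable module, holds on the
    module presented by [A], where it says that [C = D A + B E].  The limit
    shows that [S] is not regular. *)

Set Implicit Arguments.
Unset Strict Implicit.
Unset Printing Implicit Defensive.

Import Order.TTheory GRing.Theory Num.Theory.

Local Open Scope ring_scope.

(** * Finitely generated projective modules as retracts of free modules *)

Lemma ex_linear (R : pzRingType) (U V : lmodType R) (f : U -> V) :
  linear f -> exists g : {linear U -> V}, g =1 f.
Proof.
move=> lin_f; pose L := GRing.isLinear.Build R U V *:%R f lin_f.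
by pose g : {linear U -> V} := HB.pack f L; exists g.
Qed.

Lemma ex_linear_rV (R : pzRingType) (n : nat) (M : lmodType R) (v : 'I_n -> M) :
  exists g : {linear 'rV[R]_n -> M}, forall u, g u = \sum_i u 0 i *: v i.
Proof.
apply: ex_linear => a u w; rewrite scaler_sumr -big_split /=.
by apply: eq_bigr => i _; rewrite !mxE scalerDl scalerA.
Qed.

Definition free_retract (R : pzRingType) (P : lmodType R) : Prop :=
  exists (n : nat) (i : {linear P -> 'rV[R]_n}) (p : {linear 'rV[R]_n -> P}),
    cancel i p.

Lemma fg_projective_free_retract (R : pzRingType) (P : lmodType R) :
  finitely_generated P -> projective P -> free_retract P.
Proof.
move=> [n [v gen_v]] projP; have [p pE] := ex_linear_rV v.
have [|i iK] := projP 'rV[R]_n P p idfun.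
  move=> y; have [a ->] := gen_v y; exists (\row_j a j); rewrite pE.
  by apply: eq_bigr => j _; rewrite mxE.
by exists n, i, p.
Qed.

(** Projectivity for linear relations: related values are picked for the images of the basis vectors
    and extended linearly. This lets a chain map and a homotopy be chosen together in one degree. *)
Lemma free_retract_choice (R : pzRingType) (P M : lmodType R)
    (rel : P -> M -> Prop) :
  free_retract P ->
  (forall a x y u w, rel x u -> rel y w -> rel (a *: x + y) (a *: u + w)) ->
  rel 0 0 -> (forall x, exists u, rel x u) ->
  exists f : {linear P -> M}, forall x, rel x (f x).
Proof.
move=> [n [i [p ipK]]] rel_lin rel0 rel_tot.
have /fin_all_exists [w rel_w] (j : 'I_n) := rel_tot (p (delta_mx 0 j)).
have [g gE] := ex_linear_rV w.
exists (g \o i) => x; rewrite /= gE.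
have xE : x = \sum_j i x 0 j *: p (delta_mx 0 j).
  rewrite -[LHS]ipK [X in p X]row_sum_delta linear_sum.
  by apply: eq_bigr => j _; rewrite linearZ.
rewrite {1}xE; elim/big_rec2: _ => // j u y _ rel_y; exact: rel_lin.
Qed.

(** * Matrix conditions and their transfer to projective modules *)

Definition col_local_unit (R : pzRingType) : Prop :=
  forall m n p (A : 'M[R]_(m, n)) (B : 'M[R]_(n, p)), A *m B = 0 ->
    exists2 W : 'M[R]_n, A *m W = 0 & W *m B = B.

Definition row_extension (R : pzRingType) : Prop :=
  forall m n p q (A : 'M[R]_(m, n)) (B : 'M[R]_(p, q)) (C : 'M[R]_(m, q)),
    (forall x : 'rV_m, x *m A = 0 -> exists y : 'rV_p, x *m C = y *m B) ->
    exists D E, C = A *m D + E *m B.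

Definition row_local_unit (R : pzRingType) : Prop :=
  forall m n p (A : 'M[R]_(m, n)) (B : 'M[R]_(n, p)), A *m B = 0 ->
    exists2 W : 'M[R]_n, W *m B = 0 & A *m W = A.

(** Composing with the inclusions and projections of the retracts gives matrices; the kernel
    condition survives because the inclusions are injective. *)
Lemma projective_extension (R : pzRingType) (P1 P0 Q1 Q0 : lmodType R)
    (d : {linear P1 -> P0}) (e : {linear Q1 -> Q0}) (f : {linear P1 -> Q0}) :
  row_extension R ->
  free_retract P1 -> free_retract P0 -> free_retract Q1 -> free_retract Q0 ->
  (forall x, d x = 0 -> exists y, f x = e y) ->
  exists (g : {linear P0 -> Q0}) (h : {linear P1 -> Q1}),
    forall x, f x = g (d x) + e (h x).
Proof.
move=> extR [m [i1 [p1 ip1]]] [n [i0 [p0 ip0]]] [p [j1 [q1 jq1]]]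
  [q [j0 [q0 jq0]]] f_ker.
have [x|D [E CE]] := extR _ _ _ _ (lin1_mx (i0 \o d \o p1))
    (lin1_mx (j0 \o e \o q1)) (lin1_mx (j0 \o f \o p1)).
  rewrite !mul_rV_lin1 /= => /(congr1 p0); rewrite ip0 linear0 => /f_ker [y fy].
  by exists (j1 y); rewrite mul_rV_lin1 /= jq1 fy.
exists (q0 \o (mulmxr D \o i0)), (q1 \o (mulmxr E \o i1)) => x /=.
have := congr1 (mulmx (i1 x)) CE.
rewrite mulmxDr !mulmxA !mul_rV_lin1 /= ip1 => /(congr1 q0).
by rewrite jq0 linearD jq0.
Qed.

Lemma projective_local_unit (R : pzRingType) (P1 P0 Q : lmodType R)
    (b : {linear P1 -> P0}) (a : {linear P0 -> Q}) :
  row_local_unit R -> free_retract P1 -> free_retract P0 -> free_retract Q ->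
  (forall x, a (b x) = 0) ->
  exists2 w : {linear P0 -> P0},
    forall x, a (w x) = 0 & forall x, w (b x) = b x.
Proof.
move=> luR [m [i1 [p1 ip1]]] [n [i0 [p0 ip0]]] [q [j [r jr]]] ab0.
have [|W WB AW] := luR _ _ _ (lin1_mx (i0 \o b \o p1)) (lin1_mx (j \o a \o p0)).
  apply/row_matrixP => i; rewrite row_mul row0 rowE !mul_rV_lin1 /=.
  by rewrite ip0 ab0 linear0.
exists (p0 \o (mulmxr W \o i0)) => x /=.
  have := congr1 (mulmx (i0 x)) WB.
  rewrite mulmxA mul_rV_lin1 mulmx0 /= => /(congr1 r).
  by rewrite jr linear0.
have := congr1 (mulmx (i1 x)) AW.
by rewrite mulmxA !mul_rV_lin1 /= ip1 => ->.
Qed.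

(** * Chain maps and homotopies built degree by degree *)

Lemma addrDKBD (V : zmodType) (x p y q : V) :
  x - y = x + p - (y + q) - p + q.
Proof.
by rewrite opprD addrACA -[RHS]addrA [- p + q]addrC -[q - p]opprB addrK.
Qed.

Lemma ex_update (F : int -> Type) (f : forall n, F n) (n0 : int) (g : F n0) :
  exists2 f' : forall n, F n, f' n0 = g & forall n, n != n0 -> f' n = f n.
Proof.
exists (fun n =>
  if n =P n0 is ReflectT e then ecast n (F n) (esym e) g else f n).
  by case: eqP => // e; rewrite eq_axiomK.
by move=> n; case: eqP.
Qed.

Lemma int_ind_from (P : int -> Prop) (a : int) :
  P a -> (forall n, P n -> P (n + 1)) -> forall b, a <= b -> P b.
Proof.
move=> Pa Pstep b leab; have -> : b = a + `|b - a|%N%:Z by lia.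
elim: `|b - a|%N => [|k IHk]; first by rewrite addr0.
by rewrite intS [1 + _]addrC addrA; apply: Pstep.
Qed.

Definition bounded (R : pzRingType) (X : complex R) : Prop :=
  exists N : nat, forall n : int, (N < `|n|)%N -> forall x : X n, x = 0.

Lemma homotopic_id_quasi_iso (R : pzRingType) (X : complex R)
    (f : chain_map X X) : homotopic f (cm_id X) -> quasi_iso f.
Proof.
move=> [h fh] n.
have fE x : Defs.cycle x -> f (n + 1) x = x + diff X (n + 1) (h (n + 1) x).
  move=> cx; have := fh n x; rewrite cx linear0 addr0 => /(canRL (subrK _)) ->.
  exact: addrC.
split=> [x x' cx cx' [w]|y cy].
  rewrite !fE // => e; exists (w - h (n + 1) x + h (n + 1) x').
  by rewrite linearD linearB /= -e; apply: addrDKBD.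
by exists y => //; exists (h (n + 1) y); rewrite fE // [LHS]addrAC subrr add0r.
Qed.

(** Bounded complexes of projectives lift through quasi-isomorphisms: the section [s] and the
    homotopy [h] are extended together, by induction on the degree. *)
Lemma quasi_iso_section (R : pzRingType) (Z X : complex R)
    (l : chain_map Z X) :
  quasi_iso l -> bounded X -> (forall n, free_retract (X n)) ->
  exists s : chain_map X Z, homotopic (cm_comp l s) (cm_id X).
Proof.
move=> qi_l [N X0] projX.
pose good (s : forall n, {linear X n -> Z n})
    (h : forall n, {linear X n -> X (n + 1)}) (j : int) :=
  forall x : X (j + 1), s j (diff X j x) = diff Z j (s (j + 1) x) /\
    l (j + 1) (s (j + 1) x) - x =
    diff X (j + 1) (h (j + 1) x) + h j (diff X j x).
have trivial_good s h j : (forall x : X (j + 1), x = 0) -> good s h j.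
  by move=> X_0 x; rewrite (X_0 x) !linear0 ?subr0 ?addr0.
have [|b||s [h sh]] := @int_ind_from
    (fun b => exists s h, forall j, j <= b -> good s h j) (- (N%:Z + 2)) _ _
    (N%:Z + 2) _.
- exists (fun n => \0), (fun n => \0) => j lej.
  apply: trivial_good; apply: X0; lia.
- move=> [s [h sh]].
  pose rel (x : X (b + 1 + 1)) (u : Z (b + 1 + 1) * X (b + 1 + 1 + 1)) :=
    diff Z (b + 1) u.1 = s (b + 1) (diff X (b + 1) x) /\
    l (b + 1 + 1) u.1 - x =
    diff X (b + 1 + 1) u.2 + h (b + 1) (diff X (b + 1) x).
  have [||x|f relf] := @free_retract_choice R _ _ rel (projX _).
  + move=> a x y [u1 u2] [w1 w2] [/= ru1 ru2] [/= rw1 rw2].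
    rewrite /rel /= !linearP /= ru1 rw1; split=> //.
    by rewrite addrACA -scalerDr ru2 rw2 scalerDr addrACA.
  + by rewrite /rel /= !linear0 ?subr0 ?addr0.
  (* Injectivity of [l] in homology makes [s (diff x)] a boundary [diff w]. Surjectivity one degree
     higher then corrects [w] by a cycle [z], so that the remaining defect of the homotopy is a
     boundary. *)
  + have [sd lsd] := sh b (lexx _) (diff X (b + 1) x).
    have cz : Defs.cycle (s (b + 1) (diff X (b + 1) x)).
      by rewrite /Defs.cycle -sd diffK linear0.
    have c0 : Defs.cycle (0 : Z (b + 1)) by rewrite /Defs.cycle linear0.
    have [|w wE] := (qi_l b).1 _ _ cz c0.
      exists (x + h (b + 1) (diff X (b + 1) x)).
      move: lsd; rewrite linear0 subr0 diffK linear0 addr0 linearD.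
      by move=> /(canRL (subrK _)) ->; apply: addrC.
    rewrite subr0 in wE.
    have [|z cz' [v vE]] :=
      (qi_l (b + 1)).2 (l _ w - x - h (b + 1) (diff X (b + 1) x)).
      rewrite /Defs.cycle !linearB /= -cmap_diff -wE.
      move: lsd; rewrite diffK linear0 addr0 => ->; exact: subrr.
    exists (w - z, - v); split=> /=; first by rewrite linearB wE cz' subr0.
    by rewrite linearN linearB /= -vE opprB [RHS]addrAC subrK [LHS]addrAC.
  have [s' s'E s'_] := @ex_update (fun n => {linear X n -> Z n}) s (b + 1 + 1)
    (fst \o f).
  have [h' h'E h'_] := @ex_update (fun n => {linear X n -> X (n + 1)}) h
    (b + 1 + 1) (snd \o f).
  exists s', h' => j; rewrite le_eqVlt => /predU1P[-> x|ltj].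
    have [r1 r2] := relf x.
    rewrite !s'E !h'E s'_ ?h'_ //; lia.
  have := sh j; rewrite /good !s'_ ?h'_; try lia.
  by apply; lia.
- lia.
have {}sh j : good s h j.
  have [lej|ltj] := leP j (N%:Z + 2); first exact: sh.
  by apply: trivial_good; apply: X0; lia.
exists (@ChainMap R X Z s (fun n x => (sh n x).1)).
by exists h => n x; apply: (sh n x).2.
Qed.

(** The extension condition writes the current error as [g (diff x) + diff (k x)]. Absorbing [g]
    changes the homotopy one degree lower, and the local unit makes this change harmless for the
    equation already solved there. *)
Lemma ghost_null_homotopic (R : pzRingType) (X Y : complex R)
    (f : chain_map X Y) :
  row_extension R -> row_local_unit R -> bounded X ->
  (forall n, free_retract (X n)) -> (forall n, free_retract (Y n)) ->
  (forall n (x : X (n + 1)), Defs.cycle x -> homologous (f (n + 1) x) 0) ->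
  homotopic f (cm_zero X Y).
Proof.
move=> extR luR [N X0] projX projY ghost_f.
pose good (h : forall n, {linear X n -> Y (n + 1)}) (j : int) :=
  forall x : X (j + 1),
    f (j + 1) x = diff Y (j + 1) (h (j + 1) x) + h j (diff X j x).
have trivial_good h j : (forall x : X (j + 1), x = 0) -> good h j.
  by move=> X_0 x; rewrite (X_0 x) !linear0 addr0.
have [|b||h hE] := @int_ind_from
    (fun b => exists h, forall j, j <= b -> good h j) (- (N%:Z + 2)) _ _
    (N%:Z + 2) _.
- exists (fun n => \0) => j lej.
  apply: trivial_good; apply: X0; lia.
- move=> [h hE].
  (* The error left in degree [b + 2]; it sends cycles to boundaries because [f] does. *)
  pose f' : {linear X (b + 1 + 1) -> Y (b + 1 + 1)} :=
    f (b + 1 + 1) \- (diff Y (b + 1 + 1) \o h (b + 1 + 1))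
      \- (h (b + 1) \o diff X (b + 1)).
  have [x|g [k f'E]] := @projective_extension R _ _ _ _ (diff X (b + 1))
      (diff Y (b + 1 + 1)) f' extR (projX _) (projX _) (projY _) (projY _).
    move=> dx0; have [w] := ghost_f _ _ dx0; rewrite subr0 => fw.
    exists (w - h (b + 1 + 1) x).
    by rewrite /= dx0 linear0 subr0 fw linearB.
  (* So far [diff Y \o g] is only known to vanish on boundaries. Replacing [g] by [g \o w] keeps its
     values on boundaries and makes all its values cycles. *)
  have [x|w dgw wd] := @projective_local_unit R _ _ _ (diff X (b + 1))
      (diff Y (b + 1) \o g) luR (projX _) (projX _) (projY _).
    have /(congr1 (diff Y (b + 1))) := f'E x.
    rewrite [X in _ = X]linearD diffK addr0 => /= <-.
    rewrite !linearB /= diffK subr0 -cmap_diff (hE b) // diffK linear0 addr0.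
    exact: subrr.
  have [h1 h1E h1_] := @ex_update (fun n => {linear X n -> Y (n + 1)}) h
    (b + 1) (h (b + 1) \+ (g \o w)).
  have [h2 h2E h2_] := @ex_update (fun n => {linear X n -> Y (n + 1)}) h1
    (b + 1 + 1) (h (b + 1 + 1) \+ k).
  exists h2 => j; rewrite le_eqVlt => /predU1P[-> x|ltj].
    rewrite h2E h2_ ?h1E /=; last lia.
    have /(canRL (subrK _)) /(canRL (subrK _)) -> := f'E x.
    by rewrite linearD wd /= (AC (2*1*1) ((4*2)*(3*1))).
  have [jb|nejb] := eqVneq j b.
    subst j => x; rewrite !h2_ ?h1E ?h1_; try lia.
    rewrite linearD /= -[diff Y _ (g _)]/((diff Y (b + 1) \o g) _) dgw addr0.
    exact: hE.
  have := hE j; rewrite /good !h2_ ?h1_; try lia.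
  by apply; lia.
- lia.
exists h => n x; rewrite subr0.
have [lej|ltj] := leP n (N%:Z + 2); first exact: hE.
by apply: trivial_good; apply: X0; lia.
Qed.

(** A homotopy section [s] of the left leg replaces the roof by the chain map [cm_comp r s], which
    still vanishes in homology; [X] itself serves as the apex comparing the roof with zero. *)
Lemma generating_hypothesis_of_matrices (S : pzRingType) :
  row_extension S^c -> row_local_unit S^c -> generating_hypothesis S.
Proof.
move=> extR luR X Y [Z l r qi_l] [bdX projX] [_ projY] /= ghost.
have frX n : free_retract (X n).
  by have [] := projX n; apply: fg_projective_free_retract.
have frY n : free_retract (Y n).
  by have [] := projY n; apply: fg_projective_free_retract.
have [s ls] := quasi_iso_section qi_l bdX frX.
exists X, s, (cm_id X); split=> //=; first exact: homotopic_id_quasi_iso.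
have [|h hE] := @ghost_null_homotopic _ X Y (cm_comp r s) extR luR bdX frX frY.
  move=> n x cx; apply: (ghost n x) => //.
    by rewrite /Defs.cycle -cmap_diff cx linear0.
  case: ls => h /(_ n x); rewrite cx linear0 addr0 => hx.
  by exists (h (n + 1) x).
by exists h.
Qed.

(** * Transposition between a ring and its converse *)

Definition col_extension (R : pzRingType) : Prop :=
  forall m n p q (A : 'M[R]_(n, m)) (B : 'M[R]_(q, p)) (C : 'M[R]_(q, m)),
    (forall x : 'cV_m, A *m x = 0 -> exists y : 'cV_p, C *m x = B *m y) ->
    exists D E, C = D *m A + B *m E.

Lemma row_local_unit_converse (R : pzRingType) :
  col_local_unit R -> row_local_unit R^c.
Proof.
move=> luR m n p A B AB0; have [|W BW WA] := luR p n m B^T A^T.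
  by apply: trmx_inj; rewrite trmx_mul_rev !trmxK trmx0.
exists W^T; apply: trmx_inj.
  by rewrite (@trmx_mul_rev R^c) trmxK trmx0.
by rewrite (@trmx_mul_rev R^c) trmxK.
Qed.

Lemma row_extension_converse (R : pzRingType) :
  col_extension R -> row_extension R^c.
Proof.
move=> extR m n p q A B C extC.
have [x Ax0|D [E CE]] := extR _ _ _ _ A^T B^T C^T.
  have [|y yE] := extC x^T.
    by apply: trmx_inj; rewrite (@trmx_mul_rev R^c) !trmxK trmx0.
  exists y^T; apply: trmx_inj; rewrite !trmx_mul_rev !trmxK; exact: yE.
exists D^T, E^T; apply: trmx_inj.
by rewrite CE linearD /= !(@trmx_mul_rev R^c) !trmxK.
Qed.

(** * Eventually constant sequences, with matrix equations solved term by term *)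

Section EventuallyConstant.
Variables (A : pzRingType) (T : subringClosed A).

Definition eventually_in : {pred nat -> A} :=
  fun f => `[< exists N t, t \in T /\ forall j, (N <= j)%N -> f j = t >].

Fact eventually_in_subring : subring_closed eventually_in.
Proof.
split.
- by apply/asboolP; exists 0%N, 1; split; rewrite ?rpred1.
- move=> f g /asboolP[N [t [Tt fE]]] /asboolP[M [u [Tu gE]]].
  apply/asboolP; exists (maxn N M), (t - u); split; first exact: rpredB.
  by move=> j; rewrite geq_max => /andP[Nj Mj]; rewrite -(fE j) // -(gE j).
move=> f g /asboolP[N [t [Tt fE]]] /asboolP[M [u [Tu gE]]].
apply/asboolP; exists (maxn N M), (t * u); split; first exact: rpredM.
by move=> j; rewrite geq_max => /andP[Nj Mj]; rewrite -(fE j) // -(gE j).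
Qed.

Record evseq :=
  EvSeq { evseq_val :> nat -> A; _ : evseq_val \in eventually_in }.

HB.instance Definition _ := [isSub for evseq_val].
HB.instance Definition _ := [Choice of evseq by <:].
HB.instance Definition _ :=
  GRing.SubChoice_isSubPzRing.Build (nat -> A) eventually_in evseq
    eventually_in_subring.

Definition evseq_at (j : nat) (f : evseq) : A := f j.

Fact evseq_at_zmod j : zmod_morphism (evseq_at j).
Proof. by []. Qed.
Fact evseq_at_monoid j : monoid_morphism (evseq_at j).
Proof. by []. Qed.

HB.instance Definition _ j :=
  GRing.isZmodMorphism.Build evseq A (evseq_at j) (evseq_at_zmod j).
HB.instance Definition _ j :=
  GRing.isMonoidMorphism.Build evseq A (evseq_at j) (evseq_at_monoid j).

Local Notation "M ^@ j" := (map_mx (evseq_at j) M) (at level 20).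

Lemma evseq_mx_inj m n (M M' : 'M[evseq]_(m, n)) :
  (forall j, M ^@ j = M' ^@ j) -> M = M'.
Proof.
move=> eqM; apply/matrixP => i k; apply/val_inj/funext => j.
by have /matrixP/(_ i k) := eqM j; rewrite !mxE.
Qed.

Lemma evseq_mx_lim m n (M : 'M[evseq]_(m, n)) :
  exists N (L : 'M[A]_(m, n)),
    L \is a mxOver T /\ forall j, (N <= j)%N -> M ^@ j = L.
Proof.
have /choice[N /choice[t Mt]] (ik : 'I_m * 'I_n) : exists N t, t \in T /\
    forall j, (N <= j)%N -> M ik.1 ik.2 j = t.
  exact/asboolP/(valP (M ik.1 ik.2)).
exists (\max_ik N ik), (\matrix_(i, k) t (i, k)); split.
  by apply/mxOverP => i k; rewrite mxE; case: (Mt (i, k)).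
move=> j leNj; apply/matrixP => i k; rewrite !mxE.
apply: (Mt (i, k)).2; exact: leq_trans (leq_bigmax _) leNj.
Qed.

Lemma evseq_mx_mk m n (F : nat -> 'M[A]_(m, n)) N (L : 'M[A]_(m, n)) :
  L \is a mxOver T -> (forall j, (N <= j)%N -> F j = L) ->
  exists M : 'M[evseq]_(m, n), forall j, M ^@ j = F j.
Proof.
move=> TL FL.
have evF i k : (fun j => F j i k) \in eventually_in.
  apply/asboolP; exists N, (L i k); split; first exact: (mxOverP TL).
  by move=> j Nj; rewrite FL.
exists (\matrix_(i, k) EvSeq (evF i k)) => j.
by apply/matrixP => i k; rewrite !mxE.
Qed.

Definition regular_matrices : Prop :=
  forall m n (M : 'M[A]_(m, n)), exists G, M *m G *m M = M.

Definition sub_local_unit : Prop :=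
  forall m n p (M : 'M[A]_(m, n)) (M' : 'M[A]_(n, p)),
    M \is a mxOver T -> M' \is a mxOver T -> M *m M' = 0 ->
    exists W : 'M[A]_n, [/\ W \is a mxOver T, M *m W = 0 & W *m M' = M'].

(** A purity condition on [T] in [A]. It starts from a solution over [A] because solving a single
    term of a sequence gives no more than that. *)
Definition sub_extension : Prop :=
  forall m n p q (M : 'M[A]_(n, m)) (M' : 'M[A]_(q, p)) (C : 'M[A]_(q, m)) D E,
    M \is a mxOver T -> M' \is a mxOver T -> C \is a mxOver T ->
    C = D *m M + M' *m E ->
    exists D' E', [/\ D' \is a mxOver T, E' \is a mxOver T &
                      C = D' *m M + M' *m E'].

Hypothesis regA : regular_matrices.

(** Once both matrices have reached their limits, [W] comes from [T]; at each earlier term,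
    regularity gives an idempotent whose image is the kernel of that term of [M]. *)
Lemma evseq_local_unit : sub_local_unit -> col_local_unit evseq.
Proof.
move=> luT m n p M M' MM'0.
have [N [L [TL ML]]] := evseq_mx_lim M.
have [N' [L' [TL' ML']]] := evseq_mx_lim M'.
have MM'j j : M ^@ j *m M' ^@ j = 0 by rewrite -map_mxM MM'0 map_mx0.
have [|W [TW LW WL']] := luT _ _ _ L L' TL TL'.
  by rewrite -(ML (maxn N N')) ?leq_maxl // -(ML' (maxn N N')) ?leq_maxr.
have /choice[G GE] j := regA (M ^@ j).
pose F j := if (maxn N N' <= j)%N then W else 1%:M - G j *m M ^@ j.
have [j|V VE] := @evseq_mx_mk _ _ F (maxn N N') W TW; first by rewrite /F => ->.
exists V; apply: evseq_mx_inj => j; rewrite map_mxM VE /F ?map_mx0.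
  case: ifP => [|_]; first by rewrite geq_max => /andP[? ?]; rewrite ML.
  by rewrite mulmxBr mulmx1 mulmxA GE subrr.
case: ifP => [|_]; first by rewrite geq_max => /andP[? ?]; rewrite ML'.
by rewrite mulmxBl mul1mx -mulmxA MM'j mulmx0 subr0.
Qed.

Lemma evseq_extension : sub_extension -> col_extension evseq.
Proof.
move=> extT m n p q M M' C extC.
have loc j : exists DE, C ^@ j = DE.1 *m M ^@ j + M' ^@ j *m DE.2.
  (* [K] is idempotent with image the kernel of the [j]-th term of [M]. At that term, [C K = M' E]
     yields [C = (C G) M + M' E]. *)
  have [G GE] := regA (M ^@ j); pose K := 1%:M - G *m M ^@ j.
  have /fin_all_exists[y yE] (i : 'I_m) : exists y : 'cV_p,
      C ^@ j *m (K *m delta_mx i 0) = M' ^@ j *m y.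
    (* A sequence supported at the single index [j] has limit [0], so its value at [j] may be any
       vector over [A]. *)
    pose F k : 'cV_m := if k == j then K *m delta_mx i 0 else 0.
    have [||x xE] := @evseq_mx_mk _ _ F j.+1 0.
    - by apply/mxOverP => ? ?; rewrite mxE rpred0.
    - by move=> k jk; rewrite /F gtn_eqF.
    have [|y yE] := extC x.
      apply: evseq_mx_inj => k; rewrite map_mxM xE map_mx0 /F.
      case: eqP => [->|_]; last by rewrite mulmx0.
      by rewrite mulmxA mulmxBr mulmx1 mulmxA GE subrr mul0mx.
    exists (y ^@ j); have /(congr1 (map_mx (evseq_at j))) := yE.
    by rewrite !map_mxM xE /F eqxx.
  exists (C ^@ j *m G, \matrix_(k, i) y i k 0) => /=.
  rewrite [X in _ + X](_ : _ = C ^@ j *m K).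
    by rewrite mulmxBr mulmx1 mulmxA addrC subrK.
  apply/matrixP => a i; have /matrixP/(_ a 0) := yE i.
  rewrite mulmxA -colE !mxE => ->.
  by apply: eq_bigr => k _; rewrite !mxE.
have [N1 [L1 [T1 ML]]] := evseq_mx_lim M.
have [N2 [L2 [T2 ML']]] := evseq_mx_lim M'.
have [N3 [L3 [T3 CL]]] := evseq_mx_lim C.
pose N := maxn (maxn N1 N2) N3.
have limE j : (N <= j)%N -> [/\ M ^@ j = L1, M' ^@ j = L2 & C ^@ j = L3].
  by rewrite !geq_max => /andP[/andP[? ?] ?]; split; auto.
have [D0 [E0 [TD0 TE0 L3E]]] : exists D E,
    [/\ D \is a mxOver T, E \is a mxOver T & L3 = D *m L1 + L2 *m E].
  (* The [N]-th term already carries the limit matrices, so its solution over [A] can be fed to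
     [extT]. *)
  have [[D E] /=] := loc N; have [-> -> -> CE] := limE N (leqnn N).
  exact: extT CE.
have /choice[DE CE] := loc.
have [j|D DD] :=
  @evseq_mx_mk _ _ (fun j => if (N <= j)%N then D0 else (DE j).1) N D0 TD0.
  by move=> ->.
have [j|E EE] :=
  @evseq_mx_mk _ _ (fun j => if (N <= j)%N then E0 else (DE j).2) N E0 TE0.
  by move=> ->.
exists D, E; apply: evseq_mx_inj => j; rewrite map_mxD !map_mxM DD EE.
by case: ifP => [/limE[-> -> ->]|_] //; apply: CE.
Qed.

Lemma evseq_regular :
  von_neumann_regular evseq ->
  forall t, t \in T -> exists2 y, y \in T & t = t * y * t.
Proof.
move=> reg t Tt.
have t_ev : (fun=> t) \in eventually_in by apply/asboolP; exists 0%N, t.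
have [y yE] := reg (EvSeq t_ev).
have /asboolP[N [u [Tu uE]]] := valP y; exists u => //.
by rewrite -(uE N (leqnn N)) [LHS](congr1 (evseq_at N) yE) !rmorphM.
Qed.

End EventuallyConstant.

(** * Upper triangular block equations over a regular ring *)

Lemma addr_cross (V : zmodType) (x y z t : V) : x + y = z + t -> x - z = t - y.
Proof.
by move=> e; apply/eqP; rewrite subr_eq addrAC eq_sym subr_eq e addrC.
Qed.

Lemma addr_cancel (V : zmodType) (x y z x1 x2 y1 z1 s t e : V) :
  x = x1 + x2 -> y = y1 - s -> z = z1 - t ->
  e = y1 - x1 + (z1 - x2) -> t = e - s -> x - y - z = 0.
Proof.
move=> -> -> -> eE tE; have st : s + t = e by rewrite tE addrC subrK.
rewrite !opprB (AC (2*2*2) ((1*2)*(3*5)*(4*6))) /= st eE.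
by rewrite (AC (2*(2*2)*2) ((1*4)*(2*6)*(3*7)*(5*8))) /= !subrr !addr0.
Qed.

Section TriangularEquations.
Variables (F : pzRingType) (regF : regular_matrices F).

(** The diagonal blocks are chosen asymmetrically: [W11] projects onto the kernel of [A11], [W22]
    onto the image of [B22]. As [A12 *m B22 = - (A11 *m B12)], a corner [W12] built from [G11]
    satisfies both remaining equations. *)
Lemma triangular_local_unit m n p
    (A11 A12 A22 : 'M[F]_(m, n)) (B11 B12 B22 : 'M[F]_(n, p)) :
  A11 *m B11 = 0 -> A22 *m B22 = 0 -> A11 *m B12 + A12 *m B22 = 0 ->
  exists W11 W12 W22 : 'M[F]_n,
    [/\ A11 *m W11 = 0, A22 *m W22 = 0, A11 *m W12 + A12 *m W22 = 0 &
    [/\ W11 *m B11 = B11, W22 *m B22 = B22 &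
        W11 *m B12 + W12 *m B22 = B12]].
Proof.
move=> AB11 AB22 AB12.
have [G11 A11K] := regF A11; have [H22 B22K] := regF B22.
pose W22 := B22 *m H22.
have W22B : W22 *m B22 = B22 by [].
have A12B : A12 *m B22 = - (A11 *m B12).
  by apply/eqP; rewrite -addr_eq0 addrC AB12.
exists (1%:M - G11 *m A11), (- (G11 *m A12 *m W22)), W22.
split; last split.
- by rewrite mulmxBr mulmx1 mulmxA A11K subrr.
- by rewrite mulmxA AB22 mul0mx.
- rewrite mulmxN !mulmxA -[_ *m A12 *m B22]mulmxA A12B.
  by rewrite mulmxN !mulmxA A11K mulNmx opprK subrr.
- by rewrite mulmxBl mul1mx -mulmxA AB11 mulmx0 subr0.
- by [].
rewrite mulmxBl mul1mx mulNmx -[_ *m W22 *m B22]mulmxA W22B.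
by rewrite -[_ *m A12 *m B22]mulmxA A12B mulmxN opprK !mulmxA subrK.
Qed.

(** Multiplying by [L] tests divisibility by [B]: if [L *m X = 0] then [X = B *m (H *m X)]. *)
Lemma regular_left_complement m n (B : 'M[F]_(m, n)) :
  exists L H, [/\ L *m B = 0, L *m L = L & 1%:M = L + B *m H].
Proof.
have [H BK] := regF B.
have LB : (1%:M - B *m H) *m B = 0 by rewrite mulmxBl mul1mx BK subrr.
exists (1%:M - B *m H), H; split; rewrite ?subrK //.
by rewrite mulmxBr mulmx1 mulmxA LB mul0mx subr0.
Qed.

Lemma regular_right_complement m n (A : 'M[F]_(m, n)) :
  exists K G, [/\ A *m K = 0, K *m K = K & 1%:M = K + G *m A].
Proof.
have [G AK] := regF A.
have AK0 : A *m (1%:M - G *m A) = 0 by rewrite mulmxBr mulmx1 mulmxA AK subrr.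
exists (1%:M - G *m A), G; split; rewrite ?subrK //.
by rewrite mulmxBl mul1mx -mulmxA AK0 mulmx0 subr0.
Qed.

(** The diagonal solutions [D1], [E2] are corrected by terms invisible on the diagonal, killed by
    [A11] on the right and by [B22] on the left, until the corner becomes solvable modulo [B11] and
    [A22]. The subdiagonal blocks [D21], [E21] supply the correction. *)
Lemma triangular_extension m n p q
    (A11 A12 A22 : 'M[F]_(n, m)) (B11 B12 B22 : 'M[F]_(q, p))
    (C11 C12 C22 : 'M[F]_(q, m))
    (D1 D2 D11 D12 D21 D22 : 'M[F]_(q, n))
    (E1 E2 E11 E12 E21 E22 : 'M[F]_(p, m)) :
  C11 = D1 *m A11 + B11 *m E1 -> C22 = D2 *m A22 + B22 *m E2 ->
  C11 = D11 *m A11 + B11 *m E11 + B12 *m E21 ->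
  C12 = D11 *m A12 + D12 *m A22 + (B11 *m E12 + B12 *m E22) ->
  D21 *m A11 + B22 *m E21 = 0 ->
  C22 = D21 *m A12 + D22 *m A22 + B22 *m E22 ->
  exists D11' D12' D22' E11' E12' E22',
    [/\ C11 = D11' *m A11 + B11 *m E11', C22 = D22' *m A22 + B22 *m E22' &
        C12 = D11' *m A12 + D12' *m A22 + (B11 *m E12' + B12 *m E22')].
Proof.
move=> C11E C22E C11E' C12E D21A11 C22E'.
have [L [H [LB LL H1]]] := regular_left_complement B11.
have [M [G [MA _ G1]]] := regular_left_complement A11.
have [K [J [AK KK J1]]] := regular_right_complement A22.
have [Q [I [ZQ _ I1]]] := regular_right_complement (M *m A12 *m K).
have [u uE] : exists u, u = L *m (D1 - D11) by eexists.
have [v vE] : exists v, v = (E2 - E22) *m K by eexists.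
have [w wE] : exists w, w = E21 *m G *m A12 *m K + v by eexists.
(* Up to sign, [Y] is the obstruction [L *m (C12 - D1 *m A12 - B12 *m E2) *m K] left by the
   uncorrected [D1] and [E2]. *)
have [Y YE] : exists Y, Y = u *m A12 *m K + L *m B12 *m v by eexists.
have uA : u *m A11 = L *m B12 *m E21.
  rewrite uE -mulmxA mulmxBl.
  have -> : D1 *m A11 - D11 *m A11 = B11 *m E11 + B12 *m E21 - B11 *m E1.
    by apply: addr_cross; rewrite -C11E C11E' addrA.
  by rewrite mulmxBr mulmxDr !mulmxA LB !mul0mx add0r subr0.
have Bv : B22 *m v = D21 *m A12 *m K.
  rewrite vE mulmxA mulmxBr.
  have -> : B22 *m E2 - B22 *m E22 = D21 *m A12 + D22 *m A22 - D2 *m A22.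
    by apply: addr_cross; rewrite addrC -C22E C22E' addrC.
  by rewrite mulmxBl mulmxDl -!(mulmxA _ A22) AK !mulmx0 addr0 subr0.
(* Since [Q] is killed by [M *m A12 *m K], the product [A12 *m K *m Q] is divisible by [A11], which
   brings in the equations for [E21] and [D21]. *)
have QE : A12 *m K *m Q = A11 *m (G *m A12 *m K *m Q).
  rewrite -[A12 in LHS]mul1mx G1 mulmxDl mulmxDl mulmxDl ZQ add0r.
  by rewrite !mulmxA.
have YQ : Y *m Q = L *m B12 *m w *m Q.
  rewrite YE wE mulmxDl -!(mulmxA u) QE (mulmxA u) uA.
  by rewrite mulmxDr mulmxDl !mulmxA.
have BwQ : B22 *m w *m Q = 0.
  have DA : B22 *m E21 = - (D21 *m A11).
    by apply/eqP; rewrite -addr_eq0 addrC D21A11.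
  rewrite wE mulmxDr Bv !mulmxA DA !mulNmx mulmxDl mulNmx.
  by rewrite -!(mulmxA D21) QE !mulmxA addNr.
have LY : L *m Y = Y by rewrite YE uE mulmxDr !mulmxA LL.
have YK : Y *m K = Y by rewrite YE vE mulmxDl -!mulmxA KK.
have YQK : Y *m Q *m K = Y - Y *m I *m (M *m A12 *m K).
  have -> : Q = 1%:M - I *m (M *m A12 *m K) by rewrite I1 addrK.
  by rewrite mulmxBr mulmx1 mulmxBl YK -!mulmxA KK.
(* The splitting [1%:M = Q + I *m (M *m A12 *m K)] cuts [Y] in two: [D] absorbs the second part, [E]
   absorbs [Y *m Q]. *)
have [D DE] : exists D, D = D1 - Y *m I *m M by eexists.
have [E EE] : exists E, E = E2 - w *m Q by eexists.
have [X XE] : exists X, X = C12 - D *m A12 - B12 *m E by eexists.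
have LXK : L *m X *m K = 0.
  rewrite XE !mulmxBr !mulmxBl; apply: addr_cancel YQK.
  - by rewrite C12E !mulmxDr !mulmxDl !mulmxA LB !mul0mx add0r
      -!(mulmxA _ A22) AK !mulmx0 addr0.
  - by rewrite DE mulmxBl mulmxBr mulmxBl !mulmxA LY.
  - by rewrite EE !mulmxBr mulmxBl YQ !mulmxA.
  by rewrite YE uE vE !(mulmxBr, mulmxBl) !mulmxA.
have XD : X = L *m X *m J *m A22 + B11 *m (H *m X).
  rewrite -[X in LHS]mul1mx H1 mulmxDl -[L *m X in LHS]mulmx1.
  by rewrite J1 mulmxDr LXK add0r !mulmxA.
exists D, (L *m X *m J), D2, E1, (H *m X), E; split.
- by rewrite DE mulmxBl -mulmxA MA mulmx0 subr0.
- by rewrite EE mulmxBr mulmxA BwQ subr0.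
have -> : C12 = D *m A12 + X + B12 *m E.
  by rewrite XE -addrA subrK addrC subrK.
by rewrite {1}XD !addrA.
Qed.

End TriangularEquations.

(** * The block ring and its triangular subring *)

Lemma sum_ord2 (V : nmodType) (f : 'I_2 -> V) : \sum_i f i = f 0 + f 1.
Proof. by rewrite big_ord_recl big_ord1; congr (_ + f _); apply/val_inj. Qed.

Section TriangularBlocks.
Variable F : fieldType.

(** The image in End(P) x End(S1) x End(S2) of a triangular matrix, for the
    three indecomposable modules P = F^2, S1 and S2 over the triangular ring. *)
Definition block : pzRingType := ('M[F]_2 * (F * F))%type.

Definition triangular : {pred block} :=
  fun a => [&& a.1 1 0 == 0, a.2.1 == a.1 0 0 & a.2.2 == a.1 1 1].

Lemma triangular_subring : subring_closed triangular.
Proof.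
split=> [|[a [a1 a2]] [b [b1 b2]]|[a [a1 a2]] [b [b1 b2]]].
- by rewrite unfold_in /= !mxE !eqxx.
- rewrite !unfold_in /= => /and3P[/eqP a10 /eqP-> /eqP->].
  move=> /and3P[/eqP b10 /eqP-> /eqP->].
  by rewrite !mxE a10 b10 subrr !eqxx.
rewrite !unfold_in /= => /and3P[/eqP a10 /eqP-> /eqP->].
move=> /and3P[/eqP b10 /eqP-> /eqP->].
by rewrite !mxE !sum_ord2 a10 b10 !mulr0 !mul0r !add0r !addr0 !eqxx.
Qed.

HB.instance Definition _ :=
  GRing.isSubringClosed.Build block triangular triangular_subring.

Definition entry_mx m n (i j : 'I_2) (M : 'M[block]_(m, n)) : 'M[F]_(m, n) :=
  map_mx (fun a : block => a.1 i j) M.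
Definition top_mx m n (M : 'M[block]_(m, n)) : 'M[F]_(m, n) :=
  map_mx (fun a : block => a.2.1) M.
Definition bot_mx m n (M : 'M[block]_(m, n)) : 'M[F]_(m, n) :=
  map_mx (fun a : block => a.2.2) M.

Lemma field_regular_matrices : regular_matrices F.
Proof. by move=> m n M; exists (pinvmx M); apply: mulmxKpV. Qed.

Lemma sum_fst (I : Type) (r : seq I) (f : I -> block) :
  (\sum_(i <- r) f i).1 = \sum_(i <- r) (f i).1.
Proof. exact: (raddf_sum (fst : {additive block -> 'M[F]_2})). Qed.

Lemma entry_mxM m n p i j (M : 'M[block]_(m, n)) (M' : 'M[block]_(n, p)) :
  entry_mx i j (M *m M') =
  entry_mx i 0 M *m entry_mx 0 j M' + entry_mx i 1 M *m entry_mx 1 j M'.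
Proof.
apply/matrixP => a b; rewrite !mxE sum_fst summxE -big_split /=.
by apply: eq_bigr => k _; rewrite !mxE sum_ord2.
Qed.

Lemma top_mxM m n p (M : 'M[block]_(m, n)) (M' : 'M[block]_(n, p)) :
  top_mx (M *m M') = top_mx M *m top_mx M'.
Proof. exact: (map_mxM (fst \o snd : {rmorphism block -> F})). Qed.

Lemma bot_mxM m n p (M : 'M[block]_(m, n)) (M' : 'M[block]_(n, p)) :
  bot_mx (M *m M') = bot_mx M *m bot_mx M'.
Proof. exact: (map_mxM (snd \o snd : {rmorphism block -> F})). Qed.

Lemma entry_mxD m n i j (M M' : 'M[block]_(m, n)) :
  entry_mx i j (M + M') = entry_mx i j M + entry_mx i j M'.
Proof. by apply/matrixP => a b; rewrite !mxE. Qed.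

Lemma top_mxD m n (M M' : 'M[block]_(m, n)) :
  top_mx (M + M') = top_mx M + top_mx M'.
Proof. by apply/matrixP => a b; rewrite !mxE. Qed.

Lemma bot_mxD m n (M M' : 'M[block]_(m, n)) :
  bot_mx (M + M') = bot_mx M + bot_mx M'.
Proof. by apply/matrixP => a b; rewrite !mxE. Qed.

(** Identifies matrices over 2x2 matrices with matrices of doubled size over [F], where
    pseudo-inverses exist. *)
Definition full_mx m n (M : 'M[block]_(m, n)) : 'M[F]_(m + m, n + n) :=
  block_mx (entry_mx 0 0 M) (entry_mx 0 1 M) (entry_mx 1 0 M) (entry_mx 1 1 M).

Lemma full_mxM m n p (M : 'M[block]_(m, n)) (M' : 'M[block]_(n, p)) :
  full_mx (M *m M') = full_mx M *m full_mx M'.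
Proof. by rewrite /full_mx mulmx_block !entry_mxM. Qed.

Lemma ord2P (i : 'I_2) : i = 0 \/ i = 1.
Proof. by case: i => [[|[|//]] ?]; [left | right]; apply/val_inj. Qed.

Lemma block_mxP m n (M M' : 'M[block]_(m, n)) :
  full_mx M = full_mx M' -> top_mx M = top_mx M' -> bot_mx M = bot_mx M' ->
  M = M'.
Proof.
move=> /eq_block_mx[e00 e01 e10 e11] /matrixP eT /matrixP eB.
apply/matrixP => a b; move: (eT a b) (eB a b); rewrite !mxE.
suff : (M a b).1 = (M' a b).1.
  by case: (M a b) (M' a b) => [? [? ?]] [? [? ?]] /= -> -> ->.
have ent i j : entry_mx i j M = entry_mx i j M'.
  by case: (ord2P i) (ord2P j) => -> [] ->.
by apply/matrixP => i j; have /matrixP/(_ a b) := ent i j; rewrite !mxE.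
Qed.

Lemma ex_block_mx m n (N : 'M[F]_(m + m, n + n)) (P Q : 'M[F]_(m, n)) :
  exists M, [/\ full_mx M = N, top_mx M = P & bot_mx M = Q].
Proof.
pose e (i j : 'I_2) :=
  if i == 0 then if j == 0 then ulsubmx N else ursubmx N
  else if j == 0 then dlsubmx N else drsubmx N.
exists (\matrix_(a, b) (\matrix_(i, j) e i j a b, (P a b, Q a b))).
split; try by apply/matrixP => a b; rewrite !mxE.
rewrite -[N]submxK /full_mx.
by congr block_mx; apply/matrixP => a b; rewrite !mxE.
Qed.

Lemma block_regular : regular_matrices block.
Proof.
move=> m n M.
have [G [GN GP GQ]] := ex_block_mx (pinvmx (full_mx M)) (pinvmx (top_mx M))
  (pinvmx (bot_mx M)).
by exists G; apply: block_mxP; rewrite ?full_mxM ?top_mxM ?bot_mxM ?GN ?GP ?GQ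
  mulmxKpV.
Qed.

Lemma triangular_mxP m n (M : 'M[block]_(m, n)) :
  reflect [/\ entry_mx 1 0 M = 0, top_mx M = entry_mx 0 0 M &
              bot_mx M = entry_mx 1 1 M]
    (M \is a mxOver triangular).
Proof.
apply: (iffP mxOverP) => [TM | [M10 Mt Mb] a b].
  by split; apply/matrixP => a b;
    have /and3P[/eqP e10 /eqP et /eqP eb] := TM a b; rewrite !mxE.
have /matrixP/(_ a b) := M10; have /matrixP/(_ a b) := Mt.
have /matrixP/(_ a b) := Mb; rewrite !mxE => eb et e10.
by apply/and3P; split; apply/eqP.
Qed.

Arguments triangular_mxP {m n M}.

Lemma ex_triangular_mx m n (M11 M12 M22 : 'M[F]_(m, n)) :
  exists2 M, M \is a mxOver triangular &
    [/\ entry_mx 0 0 M = M11, entry_mx 0 1 M = M12 & entry_mx 1 1 M = M22].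
Proof.
have [M [MN MP MQ]] := ex_block_mx (block_mx M11 M12 0 M22) M11 M22.
have [e00 e01 e10 e11] := eq_block_mx MN.
by exists M => //; apply/triangular_mxP; rewrite MP MQ.
Qed.

Lemma triangular_mx_eq m n (M M' : 'M[block]_(m, n)) :
  M \is a mxOver triangular -> M' \is a mxOver triangular ->
  entry_mx 0 0 M = entry_mx 0 0 M' -> entry_mx 0 1 M = entry_mx 0 1 M' ->
  entry_mx 1 1 M = entry_mx 1 1 M' -> M = M'.
Proof.
move=> /triangular_mxP[M10 Mt Mb] /triangular_mxP[M10' Mt' Mb'] e00 e01 e11.
by apply: block_mxP; rewrite /full_mx ?Mt ?Mb ?Mt' ?Mb' ?M10 ?M10'
  ?e00 ?e01 ?e11.
Qed.

Lemma entry_mx0 m n i j : entry_mx i j (0 : 'M[block]_(m, n)) = 0.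
Proof. by apply/matrixP => a b; rewrite !mxE. Qed.

Lemma triangular_sub_local_unit : sub_local_unit triangular.
Proof.
move=> m n p A B TA TB AB0.
have ent i j : entry_mx i j (A *m B) = 0 by rewrite AB0 entry_mx0.
have [A10 _ _] := triangular_mxP TA; have [B10 _ _] := triangular_mxP TB.
have := (ent 0 0, ent 0 1, ent 1 1); rewrite !entry_mxM A10 B10.
rewrite !mulmx0 !mul0mx !addr0 !add0r => -[[AB11 AB12] AB22].
have [W11 [W12 [W22 [AW11 AW22 AW12 [WB11 WB22 WB12]]]]] :=
  triangular_local_unit field_regular_matrices AB11 AB22 AB12.
have [W TW [W00 W01 W11']] := ex_triangular_mx W11 W12 W22.
have [W10 _ _] := triangular_mxP TW.
exists W; split=> //.
  by apply: triangular_mx_eq; rewrite ?mxOverM ?mxOver0 ?rpred0 // ?entry_mxM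
    ?entry_mx0 ?W10 ?A10 ?W00 ?W01 ?W11' ?mulmx0 ?mul0mx ?addr0 ?add0r.
by apply: triangular_mx_eq; rewrite ?mxOverM // ?entry_mxM
    ?W10 ?B10 ?W00 ?W01 ?W11' ?mulmx0 ?mul0mx ?addr0 ?add0r.
Qed.

(** The components of [D] and [E] outside the triangular pattern are the extra data of
    [triangular_extension]: [top_mx] and [bot_mx] give the diagonal solutions, the entries [1 0]
    give [D21] and [E21]. *)
Lemma triangular_sub_extension : sub_extension triangular.
Proof.
move=> m n p q A B C D E TA TB TC CE.
have ent i j : entry_mx i j C = entry_mx i j (D *m A + B *m E) by rewrite -CE.
have Ct : top_mx C = top_mx (D *m A + B *m E) by rewrite -CE.
have Cb : bot_mx C = bot_mx (D *m A + B *m E) by rewrite -CE.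
have [A10 At Ab] := triangular_mxP TA; have [B10 Bt Bb] := triangular_mxP TB.
have [C10 Ct' Cb'] := triangular_mxP TC.
rewrite Ct' top_mxD !top_mxM At Bt in Ct.
rewrite Cb' bot_mxD !bot_mxM Ab Bb in Cb.
have := (ent 0 0, ent 0 1, ent 1 0, ent 1 1).
rewrite !entry_mxD !entry_mxM A10 B10 C10 !mulmx0 !mul0mx !addr0 !add0r !addrA.
move=> -[[[C00 C01] C10'] C11]; rewrite -[RHS]addrA in C01.
have [D11 [D12 [D22 [E11 [E12 [E22 [e00 e11 e01]]]]]]] :=
  triangular_extension field_regular_matrices Ct Cb C00 C01 (esym C10') C11.
have [D' TD [D00 D01 D11']] := ex_triangular_mx D11 D12 D22.
have [E' TE [E00 E01 E11']] := ex_triangular_mx E11 E12 E22.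
have [D10 _ _] := triangular_mxP TD; have [E10 _ _] := triangular_mxP TE.
exists D', E'; split; [exact: TD | exact: TE |].
have TDABE : D' *m A + B *m E' \is a mxOver triangular.
  have /mxOverP TDA : D' *m A \is a mxOver triangular by apply: mxOverM.
  have /mxOverP TBE : B *m E' \is a mxOver triangular by apply: mxOverM.
  by apply/mxOverP => i j; rewrite mxE rpredD.
by apply: (triangular_mx_eq TC TDABE); rewrite ?entry_mxD ?entry_mxM
  ?A10 ?B10 ?D10 ?E10 ?D00 ?D01 ?D11' ?E00 ?E01 ?E11'
  ?mulmx0 ?mul0mx ?addr0 ?add0r.
Qed.

Lemma triangular_not_regular :
  exists2 a, a \in triangular & forall b, b \in triangular -> a <> a * b * a.
Proof.
(* For this nilpotent [a], the product [a * b * a] is [a] scaled by the entry [b 1 0], which is zero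
   for triangular [b]. *)
exists (delta_mx 0 1, (0, 0)); first by rewrite unfold_in /= !mxE !eqxx.
move=> [b b'] /and3P[/= /eqP b10 _ _] [/matrixP/(_ 0 1)].
rewrite !mxE !sum_ord2 !mxE !sum_ord2 !mxE /= b10.
rewrite !(mul0r, mulr0, mulr1, mul1r, addr0, add0r) => /eqP.
by rewrite oner_eq0.
Qed.

End TriangularBlocks.

Theorem theorem3p5 :
  exists S : pzRingType, generating_hypothesis S /\ ~ von_neumann_regular S.
Proof.
exists (evseq (@triangular rat)); split.
  apply: generating_hypothesis_of_matrices.
    apply: row_extension_converse; apply: evseq_extension.
      exact: block_regular.
    exact: triangular_sub_extension.
  apply: row_local_unit_converse; apply: evseq_local_unit.
    exact: block_regular.
  exact: triangular_sub_local_unit.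
move=> /evseq_regular reg; have [a Ta nreg_a] := triangular_not_regular rat.
by have [b Tb] := reg a Ta; apply: nreg_a.
Qed.
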